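(* Let $V$ be a vertex algebra over $\mathbb{C}$ with vacuum vector $\mathbf{1}$. Let $f\in\mathbb{C}((z))$ be either $f(z)=z^{-1}$ or (the Laurent expansion at $z=0$ of) $f(z)=c\,\dfrac{e^{cz}}{e^{cz}-1}$ for some $c\in\mathbb{C}$, $c\neq 0$, and let $g=\partial_z f$. Then the quotient vector space $V/V_{(g)}V$ is an associative algebra with respect to the $f$-product (i.e. the $f$-product $a\otimes b\mapsto a_{(f)}b$ on $V$ descends to a well-defined associative product on $V/V_{(g)}V$), and the class of $\mathbf{1}$ is a unit.
   Context: A vertex algebra is a complex vector space $V$ with a linear map $V\otimes V\to V((z))$, $a\otimes b\mapsto a(z)b=\sum_{n\in\mathbb{Z}}a(n)b\,z^{-n-1}$, a vector $\mathbf{1}\in V$ and $T\in\mathrm{End}(V)$, satisfying: the Borcherds identity $[a(x)b](w)=\mathrm{Res}_z\big(a(z)b(w)\,i_{z,w}-b(w)a(z)\,i_{w,z}\big)\delta(x,z-w)\,dz$; the vacuum axiom $\mathbf{1}(z)=1_V$ and $a(z)\mathbf{1}\in a+zV[[z]]$; and translation invariance $[Ta](z)=\partial_z a(z)$. Here $\delta(z,w)=\sum_{n\in\mathbb{Z}}z^{-n-1}w^n$, $i_{z,w}$ (resp. $i_{w,z}$) denotes expansion of powers of $z-w$ in non-negative powers of $w$ (resp. of $z$), and $\mathrm{Res}_z$ takes the coefficient of $z^{-1}$. For a Laurent series $f\in\mathbb{C}((z))$ and $a,b\in V$, the $f$-product is $a_{(f)}b=\mathrm{Res}_z\, f(z)\,a(z)b\,dz\in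 V$. For a Laurent series $g$, $V_{(g)}V$ denotes the $\mathbb{C}$-linear span of all $a_{(g)}b$ with $a,b\in V$. *)

(* Defs.v *)
From HB Require Import structures.
From mathcomp Require Import all_boot all_order all_algebra.
From mathcomp Require Import generic_quotient ring_quotient.
From mathcomp Require Import zify.
From mathcomp Require Import boolp classical_sets cardinality fsbigop.

Set Implicit Arguments.
Unset Strict Implicit.
Unset Printing Implicit Defensive.

Import Order.TTheory GRing.Theory Num.Theory.
Local Open Scope ring_scope.

(* A formal series in z^{+-1} with coefficients in U is a function int -> U
   (k maps to the coefficient of z^k), a formal series in two variables a
   function int -> int -> U.  The sums \sum_(i \in A) are those of fsbigop:
   all those below have finite support when the arguments are Laurent series. *)

Section Laurent.
Variables (K : fieldType) (U : lmodType K).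

Definition is_laurent (u : int -> U) : Prop :=
  exists N : int, forall k, k < N -> u k = 0.

Definition laurent_mul (f : int -> K) (u : int -> U) : int -> U :=
  fun k => \sum_(i \in [set: int]) f i *: u (k - i).

Definition laurent_mul2 (e : int -> int -> K) (u : int -> int -> U) :
    int -> int -> U :=
  fun k l => \sum_(i \in [set: int * int]) e i.1 i.2 *: u (k - i.1) (l - i.2).

Definition laurent_deriv (u : int -> U) : int -> U :=
  fun k => (k + 1)%:~R *: u (k + 1).

Definition Res (u : int -> U) : U := u (- 1).

(* residue in the first variable *)
Definition Res_z (u : int -> int -> U) : int -> U := u (- 1).

End Laurent.

Section Expansions.
Variable K : fieldType.

Definition monomial (n : int) : int -> K := fun k => (k == n)%:R.

Definition gbinom (n : int) (j : nat) : K :=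
  (\prod_(i < j) (n - i%:Z)%:~R) / j`!%:R.

(* i_{z,w} (z - w)^n = \sum_(j >= 0) binom(n, j) z^(n - j) (- w)^j *)
Definition i_zw (n : int) : int -> int -> K :=
  fun r s => if s is Posz j then
               if r == n - s then gbinom n j * (- 1) ^+ j else 0
             else 0.

(* i_{w,z} (z - w)^n = \sum_(j >= 0) binom(n, j) z^j (- w)^(n - j) *)
Definition i_wz (n : int) : int -> int -> K :=
  fun r s => if r is Posz j then
               if s == n - r then gbinom n j * (- 1) ^ (n - r) else 0
             else 0.

(* Coefficient of x^p in delta(x, z - w) = \sum_n x^(- n - 1) (z - w)^n, with
   z - w expanded by i_{z,w}, resp. by i_{w,z}. *)
Definition delta_zw (p : int) : int -> int -> K := i_zw (- p - 1).
Definition delta_wz (p : int) : int -> int -> K := i_wz (- p - 1).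

Definition exp_series (c : K) : int -> K :=
  fun k => if k is Posz n then c ^+ n / n`!%:R else 0.

(* f is the quotient num / den in the field of Laurent series. *)
Definition laurent_quotient (num den f : int -> K) : Prop :=
  is_laurent (f : int -> K^o) /\
  laurent_mul f (den : int -> K^o) = num.

(* f = c e^{cz} / (e^{cz} - 1) *)
Definition is_exp_kernel (c : K) (f : int -> K) : Prop :=
  laurent_quotient (fun k => c * exp_series c k)
    (fun k => exp_series c k - monomial 0 k) f.

End Expansions.

(* The condition is_exp_kernel defines exactly one series. *)
Section ExpKernel.
Variable K : numFieldType.
Implicit Types (c : K) (f d : int -> K).

Lemma laurent_mul_sum f d (N : int) (n : nat) :
    (forall k, k < N -> f k = 0) -> (forall k, k < 1 -> d k = 0) ->
  laurent_mul f (d : int -> K^o) (N + n%:Z) =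
    \sum_(j < n) f (N + j%:Z) * d (n%:Z - j%:Z).
Proof.
move=> f0 d0; rewrite /laurent_mul.
rewrite (fsbigE [seq N + j%:Z | j <- iota 0 n]) //; first last.
- move=> i _ niN; have [iN|Ni] := ltP i N; first by rewrite f0 ?scale0r.
  rewrite (d0 (_ - _)) ?scaler0 //; rewrite ltNge; apply/negP => h.
  move/negP: niN; apply; apply/mapP; exists `|i - N|%N; last by lia.
  by rewrite mem_iota; lia.
- by rewrite map_inj_uniq ?iota_uniq // => i j; lia.
rewrite big_map; under eq_bigl do rewrite in_setT.
have -> : iota 0 n = index_iota 0 n by rewrite /index_iota subn0.
rewrite big_mkord; apply: eq_bigr => j _.
by rewrite [LHS]/(_ * _); congr (_ * d _); lia.
Qed.

Let num c k := c * exp_series c k.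
Let den c k := exp_series c k - monomial K 0 k.

Let den0 c k : k < 1 -> den c k = 0.
Proof.
by case: k => [[|//]|n] _; rewrite /den /monomial /= ?subrr // expr0 fact0 divr1 subrr.
Qed.

Let den1 c : den c 1 = c.
Proof. by rewrite /den /monomial /= expr1 divr1 subr0. Qed.

Fixpoint exp_kernel_prefix c (n : nat) : seq K :=
  if n is m.+1 then
    let s := exp_kernel_prefix c m in
    rcons s ((num c m%:Z - \sum_(j < m) s`_j * den c (m.+1%:Z - j%:Z)) / c)
  else [::].

Definition exp_kernel c : int -> K :=
  fun k => if k + 1 is Posz n then (exp_kernel_prefix c n.+1)`_n else 0.

Let size_prefix c n : size (exp_kernel_prefix c n) = n.
Proof. by elim: n => //= n IH; rewrite size_rcons IH. Qed.

Let nth_prefix c n m : (m < n)%N ->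
  (exp_kernel_prefix c n)`_m = exp_kernel c (- 1 + m%:Z).
Proof.
move=> mn; rewrite /exp_kernel; have -> : - 1 + m%:Z + 1 = m by lia.
elim: n mn => // n IH; rewrite ltnS leq_eqVlt => /orP[/eqP->//|mn].
by rewrite [in LHS]/= nth_rcons size_prefix mn IH.
Qed.

Lemma is_exp_kernel_exp_kernel c : c != 0 -> is_exp_kernel c (exp_kernel c).
Proof.
move=> c0; have f0 k : k < - 1 -> exp_kernel c k = 0.
  by rewrite /exp_kernel; case E : (k + 1) => [n|//]; lia.
split; first by exists (- 1).
apply/funext => k; have [k0|k0] := ltP k 0.
  rewrite -[LHS]/(laurent_mul _ (den c : int -> K^o) k).
  rewrite /laurent_mul fsbig1 => [|i _].
    by case: k k0 => // n _; rewrite mulr0.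
  have [iN|Ni] := ltP i (- 1); first by rewrite f0 ?scale0r.
  by rewrite den0 ?scaler0 //; lia.
case: k k0 => // n _.
have -> : Posz n = - 1 + n.+1%:Z by lia.
rewrite (laurent_mul_sum _ f0 (@den0 c)) big_ord_recr /=.
have -> : n.+1%:Z - n%:Z = 1 by lia.
rewrite den1 -(@nth_prefix c n.+1 n) //= nth_rcons size_prefix ltnn eqxx.
rewrite divfK // addrC; under [X in _ - X]eq_bigr do rewrite nth_prefix //.
by rewrite subrK subn1.
Qed.

Lemma is_exp_kernel_uniq c f1 f2 : c != 0 ->
  is_exp_kernel c f1 -> is_exp_kernel c f2 -> f1 = f2.
Proof.
move=> c0 [[N1 f10] E1] [[N2 f20] E2]; pose N := Num.min N1 N2.
have {}f10 k : k < N -> f1 k = 0 by rewrite lt_min => /andP[/f10].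
have {}f20 k : k < N -> f2 k = 0 by rewrite lt_min => /andP[_ /f20].
suff H n : f1 (N + n%:Z) = f2 (N + n%:Z).
  apply/funext => k; have [kN|Nk] := ltP k N; first by rewrite f10 ?f20.
  by have -> : k = N + `|k - N|%N%:Z by lia.
have [m] := ubnP n; elim: m n => // m IH n nm.
have : laurent_mul f1 (den c : int -> K^o) (N + n.+1%:Z) =
       laurent_mul f2 (den c : int -> K^o) (N + n.+1%:Z).
  by rewrite [LHS](congr1 (@^~ _) E1) [RHS](congr1 (@^~ _) E2).
rewrite !(laurent_mul_sum _ _ (@den0 c)) // !big_ord_recr /=.
have -> : \sum_(j < n) f1 (N + j%:Z) * den c (n.+1%:Z - j%:Z) =
          \sum_(j < n) f2 (N + j%:Z) * den c (n.+1%:Z - j%:Z).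
  by apply: eq_bigr => j _; rewrite IH //; have := ltn_ord j; lia.
have -> : n.+1%:Z - n%:Z = 1 by lia.
by rewrite den1 => /addrI /mulIf; apply.
Qed.

End ExpKernel.

Record vertex_algebra (K : fieldType) (V : lmodType K) := VertexAlgebra {
  (* Y a b k is the coefficient of z^k in a(z)b, i.e. a(- k - 1)b *)
  Y : V -> V -> int -> V;
  vac : V;
  trans : {linear V -> V};
  Y_linearl : forall b k, linear (fun a => Y a b k);
  Y_linearr : forall a k, linear (fun b => Y a b k);
  Y_laurent : forall a b, is_laurent (Y a b);
  (* coefficient of x^p in the Borcherds identity, applied to c *)
  borcherds : forall (a b c : V) (p q : int),
    Y (Y a b p) c q =
      Res_z (laurent_mul2 (delta_zw K p) (fun k l => Y a (Y b c l) k)) q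
      - Res_z (laurent_mul2 (delta_wz K p) (fun k l => Y b (Y a c k) l)) q;
  vac_left : forall a k, Y vac a k = if k == 0 then a else 0;
  vac_right : forall a, Y a vac 0 = a;
  vac_right_reg : forall a k, k < 0 -> Y a vac k = 0;
  trans_inv : forall a b, Y (trans a) b = laurent_deriv (Y a b)
}.

Section Products.
Variables (K : fieldType) (V : lmodType K) (VA : vertex_algebra V).

Definition f_product (f : int -> K) (a b : V) : V := Res (laurent_mul f (Y VA a b)).

Definition f_product_span (g : int -> K) : {pred V} :=
  fun v => `[< exists s : seq (K * (V * V)),
                 v = \sum_(t <- s) t.1 *: f_product g t.2.1 t.2.2 >].

Lemma f_product_span_submod_closed g : submod_closed (f_product_span g).
Proof.
split=> [|k u v /asboolP[s ->] /asboolP[t ->]].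
  by apply/asboolP; exists [::]; rewrite big_nil.
apply/asboolP; exists ([seq (k * x.1, x.2) | x <- s] ++ t).
rewrite big_cat big_map scaler_sumr /=; congr (_ + _).
by apply: eq_bigr => i _; rewrite scalerA.
Qed.

HB.instance Definition _ g :=
  GRing.isSubmodClosed.Build K V (f_product_span g) (f_product_span_submod_closed g).

End Products.

Section Quotient.
Variables (K : fieldType) (V : lmodType K) (VA : vertex_algebra V).
Variable g : int -> K.

(* The vector space V / V_(g)V; ring_quotient only gives the additive group. *)
Definition quot_space : Type := Quotient.quot (f_product_span VA g).
HB.instance Definition _ := GRing.Zmodule.on quot_space.

Definition qclass (v : V) : quot_space := \pi_(Quotient.quot (f_product_span VA g))%qT v.

Definition quot_scale (k : K) (x : quot_space) : quot_space :=
  qclass (k *: repr (x : Quotient.quot (f_product_span VA g))).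

Lemma qclass_eq u v : qclass u = qclass v <-> u - v \in f_product_span VA g.
Proof. by rewrite Quotient.idealrBE; split=> [/eqP|/eqP]. Qed.

Lemma qclass_surj x : exists v, x = qclass v.
Proof. by exists (repr (x : Quotient.quot (f_product_span VA g))); rewrite /qclass reprK. Qed.

Lemma qclassD u v : qclass (u + v) = qclass u + qclass v.
Proof. by rewrite /qclass !piE. Qed.

Lemma quot_scaleE k v : quot_scale k (qclass v) = qclass (k *: v).
Proof.
apply/qclass_eq; rewrite -scalerBr rpredZ //; apply/qclass_eq.
by rewrite /qclass reprK.
Qed.

Fact quot_scaleA a b v : quot_scale a (quot_scale b v) = quot_scale (a * b) v.
Proof. by have [u ->] := qclass_surj v; rewrite !quot_scaleE scalerA. Qed.

Fact quot_scale1 : left_id 1 quot_scale.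
Proof. by move=> v; have [u ->] := qclass_surj v; rewrite quot_scaleE scale1r. Qed.

Fact quot_scaleDr : right_distributive quot_scale +%R.
Proof.
move=> k x y; have [u ->] := qclass_surj x; have [v ->] := qclass_surj y.
by rewrite -qclassD !quot_scaleE scalerDr qclassD.
Qed.

Fact quot_scaleDl x : {morph quot_scale^~ x : a b / a + b}.
Proof.
by move=> a b; have [u ->] := qclass_surj x; rewrite !quot_scaleE scalerDl qclassD.
Qed.

HB.instance Definition _ := GRing.Zmodule_isLmodule.Build K quot_space
  quot_scaleA quot_scale1 quot_scaleDr quot_scaleDl.

Lemma qclass_is_linear : linear qclass.
Proof. by move=> k u v; rewrite qclassD -quot_scaleE. Qed.

HB.instance Definition _ := GRing.isLinear.Build K V quot_space _ qclass qclass_is_linear.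

End Quotient.

(* The algebra may be zero, so algType, which requires 1 != 0, is not usable. *)
Definition is_unital_assoc_algebra (K : fieldType) (A : lmodType K)
    (mul : A -> A -> A) (one : A) : Prop :=
  [/\ forall y, linear (fun x => mul x y), forall x, linear (mul x),
      associative mul, left_id one mul & right_id one mul].

(* Main.v *)
(* In both cases f has a simple pole with residue 1 and satisfies the Riccati
   equation f^2 = c f - f', with c = 0 for f = 1/z; the latter forces
   f(-z) = c - f(z).  Let g = f' and I = V_(g)V.  Since a_(h')b = - (Ta)_(h)b,
   the series h with V_(h)V contained in I are stable under derivation, and the
   Riccati equation rewrites (f^n g)' as a combination of f^n g and f^(n+1) g,
   so they contain the span of all f^n g; this span is stable under derivation
   and under multiplication by f.
   By the Borcherds identity, (a_(f)b)_(f)c is the residue of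
   f(w) (f(z-w) a(z)b(w)c - f(z-w) b(w)a(z)c), with f(z-w) expanded in w in the
   first term and in z in the second.  In the first term the coefficient of w^0
   in f(z-w) is f(z), which gives a_(f)(b_(f)c), and the others are multiples of
   derivatives of g, hence contribute to I.  In the second, the coefficient of
   z^0 in f(z-w) f(w) is (c - f(w)) f(w) = g(w), and the others are multiples of
   f(w) g^(j)(w): everything is in I.  So the f-product is associative modulo I.
   As T is a derivation and a_(g)b = - (Ta)_(f)b, this also makes I a two-sided
   ideal. *)
Require Import Defs.
From mathcomp Require Import all_boot all_order all_algebra.
From mathcomp Require Import reals complex.
From mathcomp Require Import boolp classical_sets cardinality fsbigop zify ring.
Import Order.TTheory GRing.Theory Num.Theory.
Local Open Scope ring_scope.
Local Open Scope complex_scope.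

Set Implicit Arguments.
Unset Strict Implicit.

Local Notation "'\zsum_' i F" := (\sum_(i \in [set: int]) F)
  (at level 34, i at level 0, F at level 34).

(** * Finitely supported sums over the integers *)

Section IntSums.
Implicit Types V : zmodType.

(** Finiteness of the support is carried as an explicit symmetric bound, since a sum with infinite
    support takes the default value 0 and explicit bounds combine by linear arithmetic. *)
Definition supp_below V (N : nat) (F : int -> V) :=
  forall i, F i != 0 -> (`|i| < N)%N.

Lemma zsumE N V (F : int -> V) : supp_below N F ->
  \zsum_i F i = \sum_(i < N.*2) F (i%:Z - N%:Z).
Proof.
move=> FN; rewrite (fsbigE [seq i%:Z - N%:Z | i <- iota 0 N.*2]) //.
- rewrite big_map; under eq_bigl do rewrite in_setT.
  have -> : iota 0 N.*2 = index_iota 0 N.*2 by rewrite /index_iota subn0.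
  by rewrite big_mkord.
- by rewrite map_inj_uniq ?iota_uniq // => i j; lia.
- move=> i _; apply: contraNeq => /FN iN; apply/mapP; exists (absz (i + N%:Z)).
    by rewrite mem_iota; lia.
  by lia.
Qed.

Lemma zsum_rev V (F : int -> V) (k : int) : \zsum_i F i = \zsum_i F (k - i).
Proof.
apply: (reindex_fsbigT (fun i => k - i)).
by exists (fun i => k - i) => i; lia.
Qed.

Lemma zsum_shift V (F : int -> V) (k : int) : \zsum_i F i = \zsum_i F (i + k).
Proof.
apply: (reindex_fsbigT (fun i => i + k)).
by exists (fun i => i - k) => i; lia.
Qed.

Lemma eq_zsum V (F G : int -> V) : F =1 G -> \zsum_i F i = \zsum_i G i.
Proof. by move=> FG; apply: eq_fsbigr => i _; exact: FG. Qed.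

Lemma zsum0 V (F : int -> V) : (forall i, F i = 0) -> \zsum_i F i = 0.
Proof. by move=> F0; apply: fsbig1 => i _; exact: F0. Qed.

Lemma zsum_only V (F : int -> V) i0 :
  (forall i, i != i0 -> F i = 0) -> \zsum_i F i = F i0.
Proof.
move=> F0; rewrite (fsbigE [:: i0]) //.
  by rewrite big_mkcond big_seq1 in_setT.
by move=> i _; rewrite inE => /F0.
Qed.

Lemma zsumD N V (F G : int -> V) : supp_below N F -> supp_below N G ->
  \zsum_i (F i + G i) = \zsum_i F i + \zsum_i G i.
Proof.
move=> FN GN; rewrite !(zsumE (N := N)) // ?big_split // => i.
have [->|/FN //] := eqVneq (F i) 0; rewrite add0r; exact: GN.
Qed.

Lemma zsum_exchange V N (H : int -> int -> V) :
    (forall i j, H i j != 0 -> (`|i| < N)%N && (`|j| < N)%N) ->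
  \zsum_i \zsum_j H i j = \zsum_j \zsum_i H i j.
Proof.
move=> HN; have H1 i : supp_below N (H i) by move=> j /HN /andP[].
have H2 j : supp_below N (H^~ j) by move=> i /HN /andP[].
rewrite (zsumE (N := N)) => [|i].
  rewrite [RHS](zsumE (N := N)) => [|j].
    under eq_bigr do rewrite (zsumE (H1 _)).
    under [RHS]eq_bigr do rewrite (zsumE (H2 _)).
    exact: exchange_big.
  apply: contraNltn => jN; rewrite zsum0 // => i.
  by apply: contraTeq jN => /HN /andP[_]; rewrite -ltnNge.
apply: contraNltn => iN; rewrite zsum0 // => j.
by apply: contraTeq iN => /HN /andP[]; rewrite -ltnNge.
Qed.

Lemma additive_zsum (V U : zmodType) (L : V -> U) N (F : int -> V) :
    (forall x y, L (x + y) = L x + L y) -> supp_below N F ->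
  L (\zsum_i F i) = \zsum_i L (F i).
Proof.
move=> LD FN; have L0 : L 0 = 0 by apply: (addIr (L 0)); rewrite -LD !add0r.
have LFN : supp_below N (L \o F).
  by move=> i; have [/= ->|/FN //] := eqVneq (F i) 0; rewrite L0 eqxx.
rewrite (zsumE FN) [RHS](zsumE LFN).
by elim/big_rec2: _ => // i x y _ <-; rewrite LD.
Qed.

(** Scaling by a nonzero [x] preserves the support, finite or not, so both sides are the same finite
    sum or both the default value 0. *)
Lemma scaler_zsum (K : fieldType) (V : lmodType K) (x : K) (F : int -> V) :
  x *: (\zsum_i F i) = \zsum_i (x *: F i).
Proof.
have [->|x0] := eqVneq x 0.
  by rewrite scale0r zsum0 // => i; rewrite scale0r.
rewrite scaler_sumr; apply: congr_big => //.
rewrite /finite_support !unlock; congr (finmap.enum_fset (fset_set _)); apply/seteqP.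
by split=> i [_ /= /eqP Fi]; split=> //=; apply/eqP; move: Fi;
   rewrite scaler_eq0 (negPf x0).
Qed.

Lemma zsum_lin (K : fieldType) (V : lmodType K) N M a (F G : int -> V) :
    supp_below N F -> supp_below M G ->
  \zsum_i (a *: F i + G i) = a *: (\zsum_i F i) + \zsum_i G i.
Proof.
move=> FN GM; have -> : a *: (\zsum_i F i) = \zsum_i (a *: F i).
  exact: additive_zsum (scalerDr a) FN.
rewrite -(zsumD (N := maxn N M)) // => i; last by move=> /GM; lia.
by rewrite scaler_eq0 negb_or => /andP[_ /FN]; lia.
Qed.

(** Meant for a(n)(b(t)c): it vanishes for n large, but how large depends on t. When t is confined
    to a finite range, the maximum of the bounds serves. *)
Lemma bound_uniform (P : int -> int -> Prop) (lo hi : int) :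
    (forall t, exists N : int, forall n, P t n -> n < N) ->
  exists N : nat, forall t n, lo <= t < hi -> P t n -> n < N%:Z.
Proof.
move=> HP; suff H (d : nat) : exists N : nat, forall t n,
    lo <= t < lo + d%:Z -> P t n -> n < N%:Z.
  have [N HN] := H (absz (hi - lo)); exists N => t n tn; apply: HN; lia.
elim: d => [|d [N IH]]; first by exists 0%N => t n; lia.
have [M HM] := HP (lo + d%:Z); exists (N + absz M)%N => t n tn Ptn.
have [/eqP E|tE] := boolP (t == lo + d%:Z).
  by have := HM n; rewrite -E => /(_ Ptn); lia.
by have : n < N%:Z; [apply: IH Ptn; lia | lia].
Qed.

Definition supp3_below (V : zmodType) (N : nat) (F : int -> int -> int -> V) :=
  forall l m j, F l m j != 0 -> [/\ (`|l| < N)%N, (`|m| < N)%N & (`|j| < N)%N].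

Lemma zsum_neq0 (V : zmodType) (F : int -> V) :
  \zsum_i F i != 0 -> exists i, F i != 0.
Proof.
move=> F0; apply: contrapT => nF; move/negP: F0; apply; apply/eqP.
by apply: zsum0 => i; apply/eqP/negPn/negP => Fi; apply: nF; exists i.
Qed.

Lemma zsum3B (V : zmodType) N (F G : int -> int -> int -> V) :
    supp3_below N F -> supp3_below N G ->
  \zsum_l \zsum_m (\zsum_j F l m j - \zsum_j G l m j) =
  \zsum_l \zsum_m \zsum_j F l m j - \zsum_l \zsum_m \zsum_j G l m j.
Proof.
have supp1 H l : supp3_below N H -> supp_below N (fun m => \zsum_j H l m j : V).
  by move=> HN m /zsum_neq0[j /HN[]].
have supp2 H : supp3_below N H ->
    supp_below N (fun l => \zsum_m \zsum_j H l m j : V).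
  by move=> HN l /zsum_neq0[m /zsum_neq0[j /HN[]]].
have zsumN (F' : int -> V) M : supp_below M F' -> - \zsum_i F' i = \zsum_i - F' i.
  exact: additive_zsum (@opprD V).
have suppN (F' : int -> V) : supp_below N F' -> supp_below N (fun i => - F' i).
  by move=> HN i; rewrite oppr_eq0; exact: HN.
move=> FN GN; rewrite (zsumN _ _ (supp2 _ GN)).
rewrite -(zsumD (supp2 _ FN) (suppN _ (supp2 _ GN))).
apply: eq_zsum => l.
rewrite (zsumN _ _ (supp1 _ l GN)).
by rewrite -(zsumD (supp1 _ l FN) (suppN _ (supp1 _ l GN))).
Qed.

Lemma zsum3_rot (V : zmodType) N (F : int -> int -> int -> V) :
    supp3_below N F ->
  \zsum_l \zsum_m \zsum_j F l m j = \zsum_j \zsum_l \zsum_m F l m j.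
Proof.
move=> FN; rewrite [RHS](zsum_exchange (N := N)).
  apply: eq_zsum => l; apply: (zsum_exchange (N := N)) => m j.
  by move=> /FN[_ -> ->].
by move=> j l /zsum_neq0[m /FN[-> _ ->]].
Qed.

Lemma zsum_antidiag (V : zmodType) N (F : int -> int -> V) :
    (forall l i, F l i != 0 -> (`|l| < N)%N && (`|i| < N)%N) ->
  \zsum_l \zsum_i F l i = \zsum_s \zsum_i F (s - i) i.
Proof.
move=> FN; rewrite (zsum_exchange FN).
(* The new index [s] stands for l + i, hence the doubled bound. *)
rewrite [RHS](zsum_exchange (N := N.*2)).
  by apply: eq_zsum => i; rewrite (zsum_shift _ (- i)).
by move=> s i /FN; lia.
Qed.

(** The expansions of (z - w)^n are homogeneous, so their coefficients live on the line r + s = n;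
    this collapses the double sums of the Borcherds identity to single ones. *)
Lemma fsbig_curve (V : zmodType) (I : choiceType) (F : I -> V) (h : int -> I) :
    injective h -> (forall p, F p != 0 -> exists j, p = h j) ->
  \sum_(p \in [set: I]) F p = \zsum_j F (h j).
Proof.
move=> hI hF; rewrite -(fsbig_image _ h); last by move=> x y _ _ /hI.
apply/esym/fsbig_widen => // p [_ np] /=.
by apply/eqP/negPn/negP => /hF[j pE]; apply: np; exists j.
Qed.

End IntSums.

(** * The differential algebra of Laurent series *)

Section LaurentAlgebra.
Variable K : fieldType.
Implicit Types (f g h : int -> K) (a c : K) (k : int).

Local Notation laurent f := (is_laurent (f : int -> K^o)).

Definition lmul f g : int -> K := laurent_mul f (g : int -> K^o).
Definition lderiv f : int -> K := laurent_deriv (f : int -> K^o).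

Local Notation D := lderiv.

Lemma lmulE f g k : lmul f g k = \zsum_i (f i * g (k - i)).
Proof. by []. Qed.

Lemma lderivE f k : D f k = (k + 1)%:~R * f (k + 1).
Proof. by []. Qed.

Lemma is_laurent2 (U W : lmodType K) (u : int -> U) (v : int -> W) :
  is_laurent u -> is_laurent v ->
  exists N : nat, forall i, (u i != 0 -> - N%:Z <= i) /\ (v i != 0 -> - N%:Z <= i).
Proof.
move=> [A uA] [B vB]; exists (absz A + absz B)%N => i; split.
  by apply: contraNle => iA; rewrite uA //; lia.
by apply: contraNle => iA; rewrite vB //; lia.
Qed.

Lemma lmul_supp (U : lmodType K) f (u : int -> U) k :
    laurent f -> is_laurent u ->
  exists N, supp_below N (fun i => f i *: u (k - i)).
Proof.
move=> fL uL; have [N HN] := is_laurent2 fL uL.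
exists (N + absz k).+1 => i; rewrite scaler_eq0 negb_or.
by move=> /andP[/(HN i).1 ? /(HN _).2 ?]; lia.
Qed.

Lemma lmulC f g : lmul f g = lmul g f.
Proof.
apply/funext => k; rewrite !lmulE (zsum_rev _ k); apply: eq_zsum => i.
by rewrite mulrC; congr (g _ * _); lia.
Qed.

Lemma laurent_lmul f g : laurent f -> laurent g -> laurent (lmul f g).
Proof.
move=> fL gL; have [N HN] := is_laurent2 fL gL.
exists (- N.*2%:Z) => k kN; apply: zsum0 => i; apply/eqP; apply: contraLR kN.
by rewrite scaler_eq0 negb_or => /andP[/(HN _).1 ? /(HN _).2 ?]; lia.
Qed.

Lemma laurent_deriv_laurent f : laurent f -> laurent (D f).
Proof.
by move=> [N fN]; exists (N - 1) => k kN; rewrite lderivE fN ?mulr0 //; lia.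
Qed.

Lemma laurentD f g : laurent f -> laurent g -> laurent (fun k => f k + g k).
Proof.
move=> fL gL; have [N HN] := is_laurent2 fL gL.
exists (- N%:Z) => k kN.
have [->|/(HN _).1] := eqVneq (f k) 0; last by lia.
have [->|/(HN _).2] := eqVneq (g k) 0; last by lia.
by rewrite add0r.
Qed.

Lemma laurentZ a f : laurent f -> laurent (fun k => a * f k).
Proof. by move=> [N fN]; exists N => k /fN ->; rewrite mulr0. Qed.

Lemma laurentB f g : laurent f -> laurent g -> laurent (fun k => f k - g k).
Proof.
move=> fL [N gN]; apply: laurentD => //.
by exists N => k /gN ->; rewrite oppr0.
Qed.

Lemma lmulZ f a g k : lmul f (fun i => a * g i) k = a * lmul f g k.
Proof. by rewrite !lmulE mulr_fsumr; apply: eq_zsum => i; rewrite mulrCA. Qed.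

Lemma lmulDr f g h k : laurent f -> laurent g -> laurent h ->
  lmul f (fun i => g i + h i) k = lmul f g k + lmul f h k.
Proof.
move=> fL gL hL; rewrite !lmulE.
have [N1 S1] := lmul_supp k fL gL; have [N2 S2] := lmul_supp k fL hL.
rewrite -(zsumD (N := maxn N1 N2)) => [|i /S1|i /S2]; [|lia|lia].
by apply: eq_zsum => i; rewrite mulrDr.
Qed.

Lemma lmulBr f g h k : laurent f -> laurent g -> laurent h ->
  lmul f (fun i => g i - h i) k = lmul f g k - lmul f h k.
Proof.
move=> fL gL hL; rewrite -[- lmul f h k]mulN1r -lmulZ -lmulDr //.
  by congr lmul; apply/funext => i; rewrite mulN1r.
exact: laurentZ.
Qed.

Lemma lmulBl f g h k : laurent f -> laurent g -> laurent h ->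
  lmul (fun i => f i - g i) h k = lmul f h k - lmul g h k.
Proof. by move=> *; rewrite lmulC lmulBr // !(lmulC h). Qed.

Lemma lmulZl a f g k : lmul (fun i => a * f i) g k = a * lmul f g k.
Proof. by rewrite lmulC lmulZ lmulC. Qed.

Lemma lmulA f g h : laurent f -> laurent g -> laurent h ->
  lmul f (lmul g h) = lmul (lmul f g) h.
Proof.
move=> fL gL hL; apply/funext => k; rewrite !lmulE.
have [N HN] := is_laurent2 fL gL; have [M HM] := is_laurent2 gL hL.
under eq_zsum do rewrite lmulE mulr_fsumr.
under [RHS]eq_zsum do rewrite lmulE mulr_fsuml.
rewrite [RHS](zsum_exchange (N := (N + N + M + absz k).+1)).
  apply: eq_zsum => i; rewrite [RHS](zsum_shift _ i); apply: eq_zsum => j.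
  by rewrite mulrA; congr (_ * g _ * h _); lia.
move=> i j; rewrite !mulf_eq0 !negb_or.
by move=> /andP[/andP[/(HN _).1 ? /(HN _).2 ?] /(HM _).2 ?]; lia.
Qed.

Lemma lderiv_mul f g k : laurent f -> laurent g ->
  D (lmul f g) k = lmul (D f) g k + lmul f (D g) k.
Proof.
move=> fL gL.
have [N1 S1] := lmul_supp (k + 1) fL gL.
rewrite lderivE !lmulE mulr_fsumr.
rewrite [X in _ = X + _](zsum_shift _ (- 1)) -(zsumD (N := N1)) => [|i|i].
- apply: eq_zsum => i; rewrite !lderivE !subrK.
  have -> : k - (i - 1) = k + 1 - i by lia.
  have -> : k - i + 1 = k + 1 - i by lia.
  (* The factor k + 1 splits as (k + 1 - i) + i, the degrees of the two coefficients being
     multiplied. *)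
  by rewrite -[X in X%:~R](subrK i (k + 1)) intrD; ring.
- rewrite lderivE subrK (_ : k - (i - 1) = k + 1 - i); last by lia.
  by rewrite -mulrA mulf_eq0 negb_or => /andP[_ /S1].
- rewrite lderivE (_ : k - i + 1 = k + 1 - i); last by lia.
  by rewrite mulrCA mulf_eq0 negb_or => /andP[_ /S1].
Qed.

Lemma lderivD f g k : D (fun i => f i + g i) k = D f k + D g k.
Proof. by rewrite !lderivE mulrDr. Qed.

Lemma lderivZ a f k : D (fun i => a * f i) k = a * D f k.
Proof. by rewrite !lderivE mulrCA. Qed.

End LaurentAlgebra.

(** * The Riccati equation and the span of the series f^n f' *)

Section Riccati.
Variable K : numFieldType.
Implicit Types (f g h u v : int -> K) (a c : K) (k : int).

Local Notation laurent f := (is_laurent (f : int -> K^o)).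
Local Notation D := (@lderiv K).

(** A nonzero Laurent series has a leading coefficient, which the hypothesis excludes. *)
Lemma laurent_eq0 u : laurent u ->
  (forall m, (forall k, k < m -> u k = 0) -> u m = 0) -> forall k, u k = 0.
Proof.
move=> [N uN] IH k; suff H (n : nat) : forall k, k < N + n%:Z -> u k = 0.
  by apply: (H (absz (k - N)).+1); lia.
elim: n => [|n IHn] {}k kn; first by apply: uN; lia.
have [/IHn//|nk] := ltP k (N + n%:Z).
by apply: IH => i ik; apply: IHn; lia.
Qed.

(** Cancellation of a factor with a simple zero, such as e^{cz} - 1: if u has leading degree m, the
    coefficient of the product in degree m + 1 is u_m v_1. *)
Lemma lmul_eq0 u v : laurent u -> (forall k, k < 1 -> v k = 0) -> v 1 != 0 ->
  (forall k, lmul u v k = 0) -> forall k, u k = 0.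
Proof.
move=> uL v0 v1 uv; apply: laurent_eq0 => // m um.
have := uv (m + 1); rewrite lmulE (zsum_only (i0 := m)) => [/eqP|i im].
  by rewrite (_ : m + 1 - m = 1) ?mulf_eq0 ?(negPf v1) ?orbF => [/eqP|]; last lia.
have [/um ->|mi] := ltP i m; first by rewrite mul0r.
by rewrite v0 ?mulr0 //; lia.
Qed.

Definition riccati c f : Prop :=
  [/\ forall k, k < - 1 -> f k = 0, f (- 1) = 1 &
      forall k, lmul f f k = c * f k - D f k].

Lemma riccati_laurent c f : riccati c f -> laurent f.
Proof. by case=> f0 _ _; exists (- 1). Qed.

Lemma riccati_monomial : riccati 0 (monomial K (- 1)).
Proof.
split=> [k k1|//|k]; first by rewrite /monomial (_ : (k == - 1) = false) //; lia.
rewrite lmulE (zsum_only (i0 := - 1)) => [|i i1]; last first.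
  by rewrite /monomial (negPf i1) mul0r.
rewrite lderivE /monomial eqxx mul1r mul0r sub0r opprK.
case: eqP => [->|_]; last by rewrite mulr0 oppr0.
by rewrite mulr1 opprK.
Qed.

Lemma exp_series_neg c k : k < 0 -> exp_series c k = 0.
Proof. by case: k. Qed.

Lemma exp_series_deriv c k : D (exp_series c) k = c * exp_series c k.
Proof.
rewrite lderivE; have [k1|k1] := ltP k (- 1).
  by rewrite !exp_series_neg ?mulr0 //; lia.
have [->|kN1] := eqVneq k (- 1); first by rewrite addNr mul0r mulr0.
have -> : k = (absz k)%:Z by lia.
move: (absz k) => n; rewrite (_ : n%:Z + 1 = n.+1%:Z); last by lia.
rewrite /= exprS factS natrM invfM -[n.+1%:~R]/(n.+1%:R : K).
have n0 : (n.+1%:R : K) != 0 by rewrite pnatr_eq0.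
by field; rewrite pnatr_eq0 -lt0n fact_gt0 addrC natr1 n0.
Qed.

(** With e = e^{cz} and d = e - 1, one has f d = c e = d'. Differentiating gives f' d = c^2 e - c f
    e, while f^2 d = c f e; so the defect of the Riccati equation is killed by d, which can be
    cancelled. *)
Lemma riccati_exp c f : c != 0 -> is_exp_kernel c f -> riccati c f.
Proof.
(* The quotient condition only bounds the pole order by some integer; uniqueness identifies f with
   the explicit solution, whose pole is at most simple. *)
move=> c0 fK; have fE : f = exp_kernel c.
  exact: is_exp_kernel_uniq c0 fK (is_exp_kernel_exp_kernel c0).
have f0 k : k < - 1 -> f k = 0.
  by rewrite fE /exp_kernel; case E : (k + 1) => [n|//]; lia.
case: fK => fL fden; set e := exp_series c in fden.
pose d k := e k - monomial K 0 k.
have {}fden k : lmul f d k = c * e k by rewrite [LHS](congr1 (@^~ k) fden).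
have d0 k : k < 1 -> d k = 0.
  case: k => [[|//]|n] _; rewrite /d /e /monomial /= ?subrr //.
  by rewrite expr0 fact0 divr1 subrr.
have d1 : d 1 = c by rewrite /d /e /monomial /= expr1 divr1 subr0.
have dL : laurent d by exists 1.
have eL : laurent e by exists 0 => -[].
have Dd k : D d k = c * e k.
  rewrite -exp_series_deriv !lderivE /d mulrBr /monomial.
  by case: eqP => [->|_]; rewrite ?mul0r ?mulr0 subr0.
split=> // [|k].
  (* In degree 0 of f d = c e only f_{-1} d_1 = c f_{-1} survives on the left, and the right side is
     c; so the residue is 1. *)
  have := fden 0; rewrite lmulE (zsum_only (i0 := - 1)) => [|i i1].
    rewrite sub0r opprK d1 /e /= expr0 fact0 divr1 mulrC => /(mulfI c0) //.
  have [iN|Ni] := ltP i (- 1); first by rewrite f0 ?mul0r.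
  by rewrite d0 ?mulr0 //; lia.
pose x k := lmul f f k - (c * f k - D f k).
suff xk : x k = 0.
  by apply/eqP; rewrite -subr_eq0; exact/eqP.
have ffL := laurent_lmul fL fL; have DfL := laurent_deriv_laurent fL.
have cfL := laurentZ c fL; have yL := laurentB cfL DfL.
apply: (@lmul_eq0 x d); rewrite ?d1 //; first exact: laurentB.
move=> {}k; rewrite !lmulBl // lmulZl -lmulA //.
have -> : lmul f d = (fun k => c * e k) by apply/funext.
have DfdE : D (fun k => c * e k) k = lmul (D f) d k + lmul f (D d) k.
  have <- : lmul f d = (fun k => c * e k) by apply/funext.
  by rewrite lderiv_mul.
have DdE : D d = (fun k => c * e k) by apply/funext.
move: DfdE; rewrite DdE !lmulZ lderivZ exp_series_deriv => ->.
by rewrite [X in _ - (X - _)]addrC addrK subrr.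
Qed.

Definition reflect_series f : int -> K := fun k => (- 1) ^ k * f k.

Lemma reflect_laurent f : laurent f -> laurent (reflect_series f).
Proof. by move=> [N fN]; exists N => k /fN fk; rewrite /reflect_series fk mulr0. Qed.

Lemma expN1D (i j : int) : (- 1) ^ (i + j) = (- 1) ^ i * (- 1) ^ j :> K.
Proof. by rewrite expfzDr // oppr_eq0 oner_eq0. Qed.

Lemma lmul_reflect f g k :
  lmul (reflect_series f) (reflect_series g) k = (- 1) ^ k * lmul f g k.
Proof.
rewrite !lmulE mulr_fsumr; apply: eq_zsum => i.
have -> : (- 1) ^ k = (- 1) ^ (k - i) * (- 1) ^ i :> K by rewrite -expN1D subrK.
by rewrite /reflect_series; ring.
Qed.

Lemma lmul_monomial0 f k : lmul f (monomial K 0) k = f k.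
Proof.
rewrite lmulE (zsum_only (i0 := k)) => [|i ik].
  by rewrite subrr /monomial eqxx mulr1.
by rewrite /monomial (_ : (k - i == 0) = false) ?mulr0 //; lia.
Qed.

(* The defect d = f(-z) + f(z) - c satisfies d' = (f(-z) - f(z)) d, and the
   leading term - 2 / z of the factor rules out a nonzero leading term of d. *)
Lemma riccati_reflect c f : riccati c f ->
  forall k, reflect_series f k = c * monomial K 0 k - f k.
Proof.
move=> Rf; have fL := riccati_laurent Rf; case: Rf => f0 f1 ff.
set r := reflect_series f; have rL : laurent r by exact: reflect_laurent.
have mL : laurent (monomial K 0).
  by exists 0 => k; rewrite /monomial; case: eqP => // ->.
have rfL := laurentD rL fL; have cL := laurentZ c mL.
pose d k := (r k + f k) - c * monomial K 0 k; pose v k := r k - f k.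
have dL : laurent d by exact: laurentB.
suff d_eq0 k : d k = 0.
  by move=> k; have /eqP := d_eq0 k; rewrite subr_eq0 => /eqP <-; rewrite addrK.
have Dd j : D d j = lmul v d j.
  have vL : laurent v by exact: laurentB.
  rewrite lmulBr // lmulDr // lmulZ lmul_monomial0 !lmulBl //.
  rewrite lmul_reflect (lmulC r f) ff !lderivE /d /v.
  have -> : r (j + 1) = - (-1) ^ j * f (j + 1).
    by rewrite /r /reflect_series expN1D expr1z mulrN1.
  rewrite /r /reflect_series /monomial; move: ((- 1) ^ j : K) => s.
  by case: (j + 1 =P 0) => [->|_]; rewrite ?mul0r ?mulr0; ring.
apply: laurent_eq0 => // m dm.
(* Negative degrees are settled directly: in degree -1 the coefficients of f(-z) and f(z) cancel,
   and below it both vanish. This leaves m >= 0, hence m + 2 nonzero. *)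
have [m0|m0] := ltP m 0.
  have dE : d m = r m + f m.
    by rewrite /d /monomial (_ : (m == 0) = false) ?mulr0 ?subr0 //; lia.
  have [/f0 fm|m1] := ltP m (- 1); first by rewrite dE /r /reflect_series fm; ring.
  by rewrite dE /r /reflect_series (_ : m = - 1) ?f1 ?exprN1 ?invrN1; [ring|lia].
(* In degree m - 1 the equation d' = v d reads m d_m = - 2 d_m. *)
have := Dd (m - 1); rewrite lderivE subrK lmulE (zsum_only (i0 := - 1)) => [|i i1].
  rewrite opprK subrK /v /r /reflect_series f1 exprN1 invrN1 => E.
  have : (m + 2)%:~R * d m = 0 by rewrite intrD mulrDl E /=; ring.
  by move/eqP; rewrite mulf_eq0 intr_eq0 => /orP[|/eqP//]; lia.
have [iN|Ni] := ltP i (- 1); last by rewrite (dm (_ - _)) ?mulr0 //; lia.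
by rewrite /v /r /reflect_series f0 //; ring.
Qed.

Definition riccati_pow f n : int -> K := iter n (lmul f) (D f).

Lemma riccati_pow_laurent c f n : riccati c f -> laurent (riccati_pow f n).
Proof.
move=> /riccati_laurent fL.
by elim: n => [|n IHn]; [exact: laurent_deriv_laurent | exact: laurent_lmul].
Qed.

Lemma riccati_deriv c f u : riccati c f -> laurent u ->
  forall k, lmul (D f) u k = c * lmul f u k - lmul f (lmul f u) k.
Proof.
move=> Rf uL k; have fL := riccati_laurent Rf.
have DfE : D f = (fun k => c * f k - lmul f f k).
  by apply/funext => i; case: Rf => _ _ ->; rewrite opprB addrC subrK.
have ffL := laurent_lmul fL fL; have cfL := laurentZ c fL.
by rewrite DfE lmulBl // lmulZl -lmulA.
Qed.

(** Induction by the Leibniz rule: f' = c f - f^2 turns f' f^n g into c f^(n+1) g - f^(n+2) g, which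
    raises each of the two numerical factors by one. *)
Lemma riccati_pow_deriv c f n k : riccati c f ->
  D (riccati_pow f n) k =
    (n.+1%:R * c) * riccati_pow f n k - n.+2%:R * riccati_pow f n.+1 k.
Proof.
move=> Rf; have fL := riccati_laurent Rf; elim: n k => [|n IHn] k.
  have DfE : D f = (fun k => c * f k + - 1 * lmul f f k).
    by apply/funext => i; case: Rf => _ _ ->; ring.
  rewrite /riccati_pow /= [in LHS]DfE lderivD !lderivZ lderiv_mul // (lmulC (D f)).
  by ring.
have hL := riccati_pow_laurent n Rf; have h1L := riccati_pow_laurent n.+1 Rf.
rewrite [LHS](lderiv_mul _ fL hL) (riccati_deriv Rf) //.
have -> : D (riccati_pow f n) = (fun k => (n.+1%:R * c) * riccati_pow f n k
    - n.+2%:R * riccati_pow f n.+1 k) by apply/funext.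
have aL := laurentZ (n.+1%:R * c) hL; have bL := laurentZ (n.+2%:R) h1L.
rewrite lmulBr // !lmulZ /riccati_pow /= -!natr1; ring.
Qed.

(** Membership is inductive so that closure properties are proved on generators and combinations.
    Multiples, zero included, come from writing a u as (a - 1) u + u. *)
Inductive riccati_span f : (int -> K) -> Prop :=
| riccati_span_pow n : riccati_span f (riccati_pow f n)
| riccati_span_lin a u v : riccati_span f u -> riccati_span f v ->
    riccati_span f (fun k => a * u k + v k).

Lemma riccati_span_scale f a u :
  riccati_span f u -> riccati_span f (fun k => a * u k).
Proof.
move=> uW; have -> : (fun k => a * u k) = (fun k => (a - 1) * u k + u k).
  by apply/funext => k; ring.
exact: riccati_span_lin.
Qed.

Lemma riccati_span_laurent c f u : riccati c f -> riccati_span f u -> laurent u.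
Proof.
move=> Rf; elim=> [n|a {}u v _ uL _ vL]; first exact: riccati_pow_laurent Rf.
exact/laurentD/vL/laurentZ.
Qed.

Lemma riccati_span_mul c f u : riccati c f ->
  riccati_span f u -> riccati_span f (lmul f u).
Proof.
move=> Rf; elim=> [n|a {}u v uW fu vW fv]; first exact: (riccati_span_pow f n.+1).
have uL := riccati_span_laurent Rf uW; have vL := riccati_span_laurent Rf vW.
have -> : lmul f (fun k => a * u k + v k) = (fun k => a * lmul f u k + lmul f v k).
  apply/funext => k; rewrite lmulDr ?lmulZ //; last exact: laurentZ.
  exact: riccati_laurent Rf.
exact: riccati_span_lin.
Qed.

Lemma riccati_span_deriv c f u : riccati c f ->
  riccati_span f u -> riccati_span f (D u).
Proof.
move=> Rf; elim=> [n|a {}u v uW Du vW Dv]; last first.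
  have -> : D (fun k => a * u k + v k) = (fun k => a * D u k + D v k).
    by apply/funext => k; rewrite lderivD lderivZ.
  exact: riccati_span_lin.
have -> : D (riccati_pow f n) = (fun k => (n.+1%:R * c) * riccati_pow f n k
    + (- n.+2%:R * riccati_pow f n.+1 k)).
  by apply/funext => i; rewrite (riccati_pow_deriv _ _ Rf) mulNr.
by apply: riccati_span_lin; [|apply: riccati_span_scale]; exact: riccati_span_pow.
Qed.

(** * The two expansions of f(z - w) *)

Definition gbinomz (n j : int) : K := if j is Posz i then gbinom K n i else 0.

(* phi f j is the coefficient of w^j in f(z - w) expanded in w, psi f j the
   coefficient of z^j in f(z - w) expanded in z, as a series in w. *)
Definition phi f (j : int) : int -> K :=
  fun r => (- 1) ^ j * gbinomz (r + j) j * f (r + j).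
Definition psi f (j : int) : int -> K :=
  fun r => (- 1) ^ r * gbinomz (r + j) j * f (r + j).

Lemma gbinomS (n : int) (j : nat) :
  j.+1%:R * gbinom K n j.+1 = gbinom K n j * (n - j%:Z)%:~R.
Proof.
rewrite /gbinom big_ord_recr factS natrM invfM /=.
have n0 : (j.+1%:R : K) != 0 by rewrite pnatr_eq0.
by field; rewrite pnatr_eq0 -lt0n fact_gt0 addrC natr1 n0.
Qed.

Lemma phi0 f : phi f 0 = f.
Proof.
apply/funext => r; rewrite /phi /= addr0 /gbinom big_ord0 fact0.
by rewrite expr0z divr1 !mul1r.
Qed.

(** Taylor's formula in recursive form: [phi f j] is (-1)^j f^(j) / j!. *)
Lemma phiS f (j : nat) : phi f j.+1%:Z = (fun k => - j.+1%:R^-1 * D (phi f j%:Z) k).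
Proof.
apply/funext => r; rewrite lderivE /phi /=.
have n0 : (j.+1%:R : K) != 0 by rewrite pnatr_eq0.
apply: (mulfI n0); rewrite [RHS]mulrA mulrN mulfV // mulN1r.
rewrite (_ : r + 1 + j%:Z = r + j.+1%:Z); last by lia.
have := gbinomS (r + j.+1%:Z) j.
rewrite (_ : r + j.+1%:Z - j%:Z = r + 1); last by lia.
rewrite -!exprnP exprS => E.
transitivity (- (- 1) ^+ j * (j.+1%:R * gbinom K (r + j.+1%:Z) j.+1)
              * f (r + j.+1%:Z)).
  by ring.
by rewrite E; ring.
Qed.

(** Expanding around -w instead of z gives the coefficient f^(j)(-w) / j!, which differs from
    [phi f j] at -w by the sign (-1)^j. *)
Lemma psi_phi f j : psi f j = (fun r => (- 1) ^ j * reflect_series (phi f j) r).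
Proof.
apply/funext => r; rewrite /psi /reflect_series /phi.
have s1 : (- 1) ^ j * (- 1) ^ j = 1 :> K by rewrite expN1r -expr2 sqrr_sign.
by rewrite -!mulrA [RHS]mulrCA [X in _ = _ * X]mulrA s1 mul1r.
Qed.

Lemma psiS f (j : nat) : psi f j.+1%:Z = (fun k => - j.+1%:R^-1 * D (psi f j%:Z) k).
Proof.
apply/funext => r; rewrite !psi_phi phiS !lderivE /reflect_series !expN1D expr1z.
have -> : (- 1) ^ j.+1%:Z = - (- 1) ^ j%:Z :> K.
  by rewrite -addn1 PoszD expN1D expr1z mulrN1.
rewrite [lderiv _ r]lderivE.
move: (_^-1) (phi f j (r + 1)) ((- 1) ^ j : K) ((- 1) ^ r : K) => q x s t.
by ring.
Qed.

Lemma phi_neg f j r : j < 0 -> phi f j r = 0.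
Proof. by case: j => // j _; rewrite /phi mulr0 mul0r. Qed.

Lemma psi_neg f j r : j < 0 -> psi f j r = 0.
Proof. by case: j => // j _; rewrite /psi mulr0 mul0r. Qed.

Lemma phi_laurent f j : laurent f -> laurent (phi f j).
Proof. by move=> [N fN]; exists (N - j) => k kN; rewrite /phi fN ?mulr0 //; lia. Qed.

Lemma psi_laurent f j : laurent f -> laurent (psi f j).
Proof. by move=> [N fN]; exists (N - j) => k kN; rewrite /psi fN ?mulr0 //; lia. Qed.

Lemma riccati_span_phi c f (j : nat) : riccati c f -> riccati_span f (phi f j.+1%:Z).
Proof.
move=> Rf; elim: j => [|j IHj]; rewrite phiS; apply: riccati_span_scale.
  by rewrite phi0; exact: (riccati_span_pow f 0).
exact: riccati_span_deriv Rf _.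
Qed.

Lemma psi0 f : psi f 0 = reflect_series f.
Proof. by apply/funext => r; rewrite psi_phi phi0 expr0z mul1r. Qed.

(** The induction can start because f(-w) = c - f(w): the derivative of [psi f 0] is -f', a multiple
    of a generator. *)
Lemma riccati_span_psi c f (j : nat) : riccati c f -> riccati_span f (psi f j.+1%:Z).
Proof.
move=> Rf; elim: j => [|j IHj]; rewrite psiS; apply: riccati_span_scale.
  have -> : D (psi f 0) = (fun k => - 1 * D f k).
    apply/funext => r; rewrite psi0 !lderivE (riccati_reflect Rf) /monomial.
    by case: (r + 1 =P 0) => [->|_]; rewrite ?mul0r ?mulr0 ?sub0r; ring.
  by apply: riccati_span_scale; exact: (riccati_span_pow f 0).
exact: riccati_span_deriv Rf _.
Qed.

Lemma riccati_span_psi_mul c f j : riccati c f -> riccati_span f (lmul (psi f j) f).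
Proof.
move=> Rf; have fL := riccati_laurent Rf.
have [n0|] := ltP j 0.
  have -> : lmul (psi f j) f = (fun k => 0 * D f k).
    by apply/funext => k; rewrite mul0r lmulE zsum0 // => i; rewrite psi_neg ?mul0r.
  exact/riccati_span_scale/(riccati_span_pow f 0).
case: j => // -[|j] _; last first.
  rewrite lmulC; exact: (riccati_span_mul Rf (riccati_span_psi j Rf)).
suff -> : lmul (psi f 0) f = D f by exact: (riccati_span_pow f 0).
apply/funext => k; rewrite psi0.
have -> : reflect_series f = (fun k => c * monomial K 0 k - f k).
  by apply/funext; exact: riccati_reflect.
have mL : laurent (monomial K 0).
  by exists 0 => i; rewrite /monomial; case: eqP => // ->.
rewrite lmulBl //; last exact: laurentZ.
rewrite lmulZl lmulC lmul_monomial0; case: Rf => _ _ ->.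
by rewrite opprB addrC subrK.
Qed.

End Riccati.

(** * Modes, iterated f-products and the translation operator *)

Section Iterate.
Variables (K : numFieldType) (V : lmodType K) (VA : vertex_algebra V).
Implicit Types (h k : int -> K) (a b c : V) (m l j : int).

Local Notation laurent f := (is_laurent (f : int -> K^o)).
Local Notation f_product := (f_product VA).

(* a(m)b, the coefficient of z^(- m - 1) in a(z)b *)
Definition nprod m a b : V := Y VA a b (- 1 - m).

Lemma f_productE h a b : f_product h a b = \zsum_m (h m *: nprod m a b).
Proof. by []. Qed.

Lemma nprod_lin_l m b x a a' :
  nprod m (x *: a + a') b = x *: nprod m a b + nprod m a' b.
Proof. exact: Y_linearl. Qed.

Lemma nprod_lin_r m a x b b' :
  nprod m a (x *: b + b') = x *: nprod m a b + nprod m a b'.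
Proof. exact: Y_linearr. Qed.

Lemma nprodDl m b a a' : nprod m (a + a') b = nprod m a b + nprod m a' b.
Proof. by rewrite -[a]scale1r nprod_lin_l !scale1r. Qed.

Lemma nprodDr m a b b' : nprod m a (b + b') = nprod m a b + nprod m a b'.
Proof. by rewrite -[b]scale1r nprod_lin_r !scale1r. Qed.

Lemma nprodZl m b x a : nprod m (x *: a) b = x *: nprod m a b.
Proof.
have n0 : nprod m 0 b = 0.
  by apply: (addrI (nprod m 0 b)); rewrite -nprodDl !addr0.
by rewrite -[x *: a]addr0 nprod_lin_l n0 addr0.
Qed.

Lemma nprodZr m a x b : nprod m a (x *: b) = x *: nprod m a b.
Proof.
have n0 : nprod m a 0 = 0.
  by apply: (addrI (nprod m a 0)); rewrite -nprodDr !addr0.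
by rewrite -[x *: b]addr0 nprod_lin_r n0 addr0.
Qed.

Lemma nprod_bound a b : exists N : int, forall n, nprod n a b != 0 -> n < N.
Proof.
have [N HN] := Y_laurent VA a b; exists (- N) => n.
by apply: contraNlt => nN; rewrite /nprod HN //; lia.
Qed.

Lemma f_product_supp h a b : laurent h ->
  exists N, supp_below N (fun m => h m *: nprod m a b).
Proof. by move=> hL; exact: lmul_supp (Y_laurent VA a b). Qed.

Lemma f_product_lin_l h b x a a' : laurent h ->
  f_product h (x *: a + a') b = x *: f_product h a b + f_product h a' b.
Proof.
move=> hL; rewrite !f_productE.
have [N HN] := f_product_supp a b hL; have [M HM] := f_product_supp a' b hL.
rewrite -(zsum_lin _ HN HM); apply: eq_zsum => m.
by rewrite nprod_lin_l scalerDr !scalerA mulrC.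
Qed.

Lemma f_product_lin_r h a x b b' : laurent h ->
  f_product h a (x *: b + b') = x *: f_product h a b + f_product h a b'.
Proof.
move=> hL; rewrite !f_productE.
have [N HN] := f_product_supp a b hL; have [M HM] := f_product_supp a b' hL.
rewrite -(zsum_lin _ HN HM); apply: eq_zsum => m.
by rewrite nprod_lin_r scalerDr !scalerA mulrC.
Qed.

(** The Borcherds identity on modes: the coefficient of x^(-1-m) in delta(x, z - w) is (z - w)^m, so
    each residue becomes a sum over the terms of a binomial expansion. *)
Lemma nprod_iterate a b c m l :
  nprod l (nprod m a b) c =
    \zsum_j (((- 1) ^ j * gbinomz K m j) *: nprod (m - j) a (nprod (l + j) b c))
    - \zsum_j (((- 1) ^ (m - j) * gbinomz K m j) *:
                 nprod (m + l - j) b (nprod j a c)).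
Proof.
rewrite [LHS](borcherds VA a b c (- 1 - m) (- 1 - l)) /delta_zw /delta_wz.
have -> : - (- 1 - m) - 1 = m by lia.
congr (_ - _); rewrite /Res_z /laurent_mul2.
  rewrite (fsbig_curve (h := fun j => (m - j, j))) => [|i j [_ //]|[r s]] /=.
    apply: eq_zsum => j; congr (_ *: _).
      rewrite /i_zw /gbinomz; case: j => [j|j]; rewrite ?eqxx ?mulr0 //.
      by rewrite mulrC exprnP.
    by rewrite /nprod; congr (Y VA a (Y VA b c _) _); lia.
  rewrite scaler_eq0 negb_or => /andP[+ _]; rewrite /i_zw.
  case: s => [j|j]; last by rewrite eqxx.
  by case: (r =P m - j%:Z) => [-> _|_]; [exists j | rewrite eqxx].
rewrite (fsbig_curve (h := fun j => (j, m - j))) => [|i j [//]|[r s]] /=.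
  apply: eq_zsum => j; congr (_ *: _).
    by rewrite /i_wz /gbinomz; case: j => [j|j]; rewrite ?eqxx ?mulr0 // mulrC.
  by rewrite /nprod; congr (Y VA b (Y VA a c _) _); lia.
rewrite scaler_eq0 negb_or => /andP[+ _]; rewrite /i_wz.
case: r => [j|j]; last by rewrite eqxx.
by case: (s =P m - j%:Z) => [-> _|_]; [exists j | rewrite eqxx].
Qed.

Lemma nprod0r m a : nprod m a 0 = 0.
Proof. by have := nprodZr m a 0 0; rewrite !scale0r. Qed.

Lemma f_productDr h a b b' : laurent h ->
  f_product h a (b + b') = f_product h a b + f_product h a b'.
Proof. by move=> hL; rewrite -[b]scale1r f_product_lin_r // !scale1r. Qed.

Lemma f_productDl h b a a' : laurent h ->
  f_product h (a + a') b = f_product h a b + f_product h a' b.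
Proof. by move=> hL; rewrite -[a]scale1r f_product_lin_l // !scale1r. Qed.

Lemma f_productZr h a (x : K) b : f_product h a (x *: b) = x *: f_product h a b.
Proof.
rewrite !f_productE scaler_zsum; apply: eq_zsum => i.
by rewrite nprodZr !scalerA mulrC.
Qed.

Lemma f_productZl h b (x : K) a : f_product h (x *: a) b = x *: f_product h a b.
Proof.
rewrite !f_productE scaler_zsum; apply: eq_zsum => i.
by rewrite nprodZl !scalerA mulrC.
Qed.

Lemma f_product_neq0 h a b : f_product h a b != 0 ->
  exists m, h m != 0 /\ nprod m a b != 0.
Proof.
rewrite f_productE => /zsum_neq0[m]; rewrite scaler_eq0 negb_or => /andP[? ?].
by exists m.
Qed.

Lemma gbinomz_ge0 m j : gbinomz K m j != 0 -> 0 <= j.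
Proof. by case: j => // j; rewrite eqxx. Qed.

(** The residue of k(w) h(z - w) times the commutator-like difference, sorted by powers of the
    expansion variable. In [X j] the factor w^j is absorbed into k(w); in the second sum z^j
    extracts a(j)c. The bound on the support of [X] is what later allows the term j = 0 to be split
    off. *)
Lemma f_product_iterate h k a b c : laurent h -> laurent k ->
  let X j := f_product (phi h j) a (f_product (fun s => k (s - j)) b c) in
  (exists N, supp_below N X) /\
  f_product k (f_product h a b) c =
    \zsum_j X j - \zsum_j f_product (lmul (psi h j) k) b (nprod j a c).
Proof.
move=> hL kL X; have [B hk] := is_laurent2 hL kL.
have hB i : h i != 0 -> - B%:Z <= i by case: (hk i).
have {hk} kB i : k i != 0 -> - B%:Z <= i by case: (hk i).
have [Nab ab_lt] := nprod_bound a b.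
have [Nbc bc_lt] := nprod_bound b c.
have [Nac ac_lt] := nprod_bound a c.
(* Nonzero terms of the first sum have l >= -B, j >= 0 and b(l + j)c nonzero, so l + j stays in this
   finite range. *)
have [N1 lt1] := bound_uniform (P := fun t n => nprod n a (nprod t b c) != 0)
  (- B%:Z) Nbc (fun t => nprod_bound _ _).
have [N2 lt2] := bound_uniform (P := fun t n => nprod n b (nprod t a c) != 0)
  0 Nac (fun t => nprod_bound _ _).
have XN : exists N, supp_below N X.
  exists (B + absz Nbc).+1 => j Xj.
  have j0 : 0 <= j.
    by rewrite leNgt; apply: contra Xj => j0; apply/eqP; apply: zsum0 => i;
       rewrite phi_neg ?scale0r.
  have : f_product (fun s => k (s - j)) b c != 0.
    apply: contraNneq Xj => Y0; rewrite /X Y0; apply/eqP; apply: zsum0 => i.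
    by rewrite [Y _ _ _ _](nprod0r i a) scaler0.
  by move=> /f_product_neq0[s [/kB ? /bc_lt ?]]; lia.
split=> //.
pose F1 l m j := (k l * h m * ((- 1) ^ j * gbinomz K m j)) *:
  nprod (m - j) a (nprod (l + j) b c).
pose F2 l m j := (k l * h m * ((- 1) ^ (m - j) * gbinomz K m j)) *:
  nprod (m + l - j) b (nprod j a c).
pose N := (B + B + B + absz Nbc + absz Nac + N1 + N2).+1.
have F1N : supp3_below N F1.
  move=> l m j; rewrite scaler_eq0 !mulf_eq0 !negb_or.
  move=> /andP[/andP[/andP[/kB kl /hB hm] /andP[_ /gbinomz_ge0 j0]] ne].
  have /bc_lt ltj : nprod (l + j) b c != 0.
    by apply: contraNneq ne => ->; rewrite nprod0r.
  have /= := lt1 (l + j) (m - j) _ ne; rewrite /N => lt.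
  by have := lt ltac:(lia); split; lia.
have F2N : supp3_below N F2.
  move=> l m j; rewrite scaler_eq0 !mulf_eq0 !negb_or.
  move=> /andP[/andP[/andP[/kB kl /hB hm] /andP[_ /gbinomz_ge0 j0]] ne].
  have /ac_lt ltj : nprod j a c != 0.
    by apply: contraNneq ne => ->; rewrite nprod0r.
  have /= := lt2 j (m + l - j) _ ne; rewrite /N => lt.
  by have := lt ltac:(lia); split; lia.
transitivity (\zsum_l \zsum_m (\zsum_j F1 l m j - \zsum_j F2 l m j)).
  rewrite f_productE; apply: eq_zsum => l.
  have [M HM] := f_product_supp a b hL.
  rewrite f_productE (additive_zsum (L := fun v => k l *: nprod l v c) _ HM).
    apply: eq_zsum => m; rewrite nprodZl nprod_iterate scalerA scalerBr !scaler_zsum.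
    by congr (_ - _); apply: eq_zsum => j; rewrite scalerA.
  by move=> x y; rewrite nprodDl scalerDr.
(* All sums live in one finite box, so they may be split and j moved outermost. *)
rewrite (zsum3B F1N F2N) (zsum3_rot F1N) (zsum3_rot F2N).
congr (_ - _); apply: eq_zsum => j.
  have kjL : laurent (fun s => k (s - j)).
    by case: kL => M kM; exists (M + j) => s sM; apply: kM; lia.
  have [M HM] := f_product_supp b c kjL.
  have phiL := phi_laurent j hL.
  rewrite /X [f_product _ b c]f_productE (additive_zsum _ HM); last first.
    by move=> x y; rewrite f_productDr.
  (* For fixed j the mode numbers s = l + j and r = m - j become the summation indices. *)
  rewrite [LHS](zsum_shift _ (- j)); apply: eq_zsum => s.
  rewrite f_productZr f_productE scaler_zsum [LHS](zsum_shift _ j).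
  apply: eq_zsum => r.
  rewrite /F1 scalerA addrK subrK /phi; congr (_ *: _); ring.
rewrite f_productE.
(* With i = m - j, b carries the mode number l + i = s; the sum over i at fixed s is then the
   coefficient of a product of series. *)
under eq_zsum do rewrite (zsum_shift _ j).
rewrite (zsum_antidiag (N := N.*2)) => [|l i /F2N[]]; last by lia.
apply: eq_zsum => s; rewrite lmulE.
have [M HM] := lmul_supp s (psi_laurent j hL) kL.
rewrite (additive_zsum (L := fun x : K => x *: nprod s b (nprod j a c)) _ HM).
  apply: eq_zsum => i; rewrite /F2 addrK (_ : i + j + (s - i) - j = s); last by lia.
  congr (_ *: _); transitivity (psi h j i * k (s - i)) => //.
  by rewrite /psi; ring.
by move=> x y; rewrite scalerDl.
Qed.

Lemma f_product_lin_h (x : K) h k a b : laurent h -> laurent k ->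
  f_product (fun i => x * h i + k i) a b = x *: f_product h a b + f_product k a b.
Proof.
move=> hL kL; rewrite !f_productE.
have [N HN] := f_product_supp a b hL; have [M HM] := f_product_supp a b kL.
rewrite -(zsum_lin _ HN HM); apply: eq_zsum => m.
by rewrite scalerDl scalerA.
Qed.

Lemma nprod_trans_l m a b : nprod m (trans VA a) b = (- m)%:~R *: nprod (m - 1) a b.
Proof.
rewrite /nprod trans_inv /laurent_deriv.
by congr (_%:~R *: Y VA a b _); lia.
Qed.

(** Integration by parts: [Ta](z) is the derivative of a(z), and a derivative has no residue. *)
Lemma f_product_deriv h a b :
  f_product (lderiv h) a b = - f_product h (trans VA a) b.
Proof.
rewrite -scaleN1r !f_productE scaler_zsum [RHS](zsum_shift _ 1).
apply: eq_zsum => m; rewrite nprod_trans_l addrK !scalerA lderivE.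
by congr (_ *: _); rewrite mulrNz; ring.
Qed.

(** The constant term of [Ta](z)1 = (a(z)1)'. *)
Lemma trans_nprod_vac a : trans VA a = nprod (- 2) a (vac VA).
Proof.
rewrite -[LHS](vac_right VA) trans_inv /laurent_deriv add0r scale1r.
by rewrite /nprod; congr (Y VA a _ _); lia.
Qed.

Lemma nprod_vac_ge0 m a : 0 <= m -> nprod m a (vac VA) = 0.
Proof. by move=> m0; rewrite /nprod vac_right_reg //; lia. Qed.

(** T is a derivation because it is the mode (-2) applied to the vacuum: in the expansion of
    (a(m)b)(-2)1 the vacuum kills all but two terms. The term j = 0 is a(m)Tb, and j = 1 is -m a(m -
    1)b = (Ta)(m)b. *)
Lemma trans_nprod m a b :
  trans VA (nprod m a b) = nprod m (trans VA a) b + nprod m a (trans VA b).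
Proof.
rewrite trans_nprod_vac nprod_iterate [X in _ - X]zsum0 => [|j].
  rewrite subr0 (zsumE (N := 2)) => [|j]; last first.
    rewrite scaler_eq0 mulf_eq0 !negb_or => /andP[/andP[_ /gbinomz_ge0 j0] ne].
    have [j2|] := ltP j 2; first by lia.
    move=> j2; move: ne; rewrite (nprod_vac_ge0 (m := - 2 + j)) ?nprod0r ?eqxx //.
    lia.
  (* The four summands are j = -2, -1, 0, 1; the negative ones have binomial coefficient 0. *)
  rewrite !big_ord_recr big_ord0 /= !mulr0 !scale0r !add0r.
  rewrite /gbinom big_ord0 big_ord_recr big_ord0 /= !subr0 !mul1r.
  rewrite nprod_trans_l addrC; congr (_ + _).
    have -> : 3%:Z - 2%:Z = 1 by [].
    have -> : ((3 - 2)`! = 1)%N by [].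
    rewrite [nprod _ b _](vac_right VA b) expr1z divr1.
    by rewrite mulN1r mulrNz.
  have -> : ((2 - 2)`! = 1)%N by [].
  by rewrite invr1 scale1r -trans_nprod_vac.
have [j0|/nprod_vac_ge0 ->] := ltP j 0; last by rewrite nprod0r scaler0.
by case: j j0 => // j _; rewrite mulr0 scale0r.
Qed.

End Iterate.

(** * The ideal I and the quotient algebra *)

Section QuotientAlgebra.
Variables (K : numFieldType) (V : lmodType K) (VA : vertex_algebra V).
Variables (c : K) (f : int -> K).
Hypothesis Rf : riccati c f.
Implicit Types (a b x y z : V) (h : int -> K).

Local Notation f_product := (f_product VA).
Local Notation I := (f_product_span VA (lderiv f)).
Local Notation T := (trans VA).

Let fL : is_laurent (f : int -> K^o) := riccati_laurent Rf.

Lemma f_product_in_span g a b : f_product g a b \in f_product_span VA g.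
Proof.
apply/asboolP; exists [:: (1, (a, b))].
by rewrite big_seq1 scale1r.
Qed.

Lemma f_product_span_ind g (P : V -> Prop) :
    P 0 -> (forall (k : K) u v, P u -> P v -> P (k *: u + v)) ->
    (forall a b, P (f_product g a b)) ->
  forall v, v \in f_product_span VA g -> P v.
Proof.
move=> P0 PD Pg v /asboolP[s ->].
by elim/big_rec: _ => // t u _ Pu; apply: PD.
Qed.

(** [riccati_pow_deriv] is solved for the power n + 1, dividing by n + 2 in characteristic zero; the
    derivative of [h] contributes to I through [f_product_deriv]. *)
Lemma riccati_pow_span n a b : f_product (riccati_pow f n) a b \in I.
Proof.
elim: n a b => [|n IHn] a b; first exact: f_product_in_span.
set h := riccati_pow f n.
have hL : is_laurent (h : int -> K^o) := riccati_pow_laurent n Rf.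
have n0 : (n.+2%:R : K) != 0 by rewrite pnatr_eq0.
have -> : riccati_pow f n.+1 = (fun i => - n.+2%:R^-1 * lderiv h i
    + (n.+2%:R^-1 * (n.+1%:R * c)) * h i).
  apply/funext => i; rewrite (riccati_pow_deriv _ _ Rf) -/h.
  by move: n0; move: (n.+2%:R : K) (n.+1%:R : K) => q p q0; field.
rewrite f_product_lin_h; last 2 first.
- exact: laurent_deriv_laurent.
- exact: laurentZ.
rewrite rpredD ?rpredZ //; first by rewrite f_product_deriv rpredN; exact: IHn.
have -> : (fun i => n.+2%:R^-1 * (n.+1%:R * c) * h i) =
    (fun i => (n.+2%:R^-1 * (n.+1%:R * c) - 1) * h i + h i).
  by apply/funext => i; rewrite mulrBl mul1r subrK.
by rewrite f_product_lin_h // rpredD ?rpredZ //; exact: IHn.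
Qed.

Lemma riccati_span_sub h : riccati_span f h -> forall a b, f_product h a b \in I.
Proof.
elim=> [n|k u v uW IHu vW IHv] a b; first exact: riccati_pow_span.
rewrite f_product_lin_h; first by rewrite rpredD ?rpredZ.
- exact: riccati_span_laurent Rf uW.
- exact: riccati_span_laurent Rf vW.
Qed.

Lemma f_product_assoc_mod x y z :
  f_product f (f_product f x y) z - f_product f x (f_product f y z) \in I.
Proof.
have [[N XN] ->] := f_product_iterate VA x y z fL fL.
set X := (X in supp_below N X) in XN *.
have X0 : X 0 = f_product f x (f_product f y z).
  rewrite /X phi0; congr (f_product f x (f_product _ y z)).
  by apply/funext => s; rewrite subr0.
rewrite -X0 addrAC rpredB //; last first.
  rewrite rpred_sum // => j _.
  by apply: riccati_span_sub; exact: riccati_span_psi_mul Rf.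
(* The term j = 0 is subtracted under the sum, so that every remaining summand lies in I. *)
have -> : X 0 = \zsum_j (if j == 0 then X 0 else 0).
  by rewrite (zsum_only (i0 := 0)) // => j /negPf ->.
rewrite -scaleN1r scaler_zsum -(zsumD (N := N.+1)) => [|j /XN|j]; [|lia|].
  rewrite rpred_sum // => j _; case: eqP => [->|j0].
    by rewrite scaleN1r subrr rpred0.
  rewrite scaler0 addr0; case: j j0 => [[//|j]|j] _.
    apply: riccati_span_sub; exact: riccati_span_phi Rf.
  rewrite /X f_productE zsum0 ?rpred0 // => i.
  by rewrite phi_neg ?scale0r.
by case: (j =P 0) => [->//|_]; rewrite scaler0 eqxx.
Qed.

Lemma f_product_transl x y : f_product f (T x) y = - f_product (lderiv f) x y.
Proof. by rewrite f_product_deriv opprK. Qed.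

Lemma trans_f_product x y :
  T (f_product f x y) = f_product f (T x) y + f_product f x (T y).
Proof.
rewrite !f_productE.
have [N HN] := f_product_supp VA x y fL; have [M HM] := f_product_supp VA (T x) y fL.
have [M' HM'] := f_product_supp VA x (T y) fL.
rewrite (additive_zsum (raddfD T) HN) -(zsumD (N := maxn M M')) => [|i /HM|i /HM'].
- apply: eq_zsum => i; rewrite -scalerDr -trans_nprod.
  exact: (linearZZ T).
- lia.
- lia.
Qed.

(** Modulo I this is (Tx)_(f)(y_(f)z), again of the form -x_(g)v. Since the generators of I are the
    -(Tx)_(f)y, it makes I stable under right multiplication. *)
Lemma span_trans_mul x y z : f_product f (f_product f (T x) y) z \in I.
Proof.
rewrite -(rpredBr _ (f_product_assoc_mod (T x) y z)) opprB addrC subrK.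
by rewrite f_product_transl rpredN f_product_in_span.
Qed.

Lemma span_mulr u z : u \in I -> f_product f u z \in I.
Proof.
move: u; apply: f_product_span_ind => [|k u v uI vI|x y].
- by rewrite -(scale0r 0) f_productZl scale0r rpred0.
- by rewrite f_product_lin_l // rpredD ?rpredZ.
rewrite -[f_product _ x y]opprK -f_product_transl -scaleN1r f_productZl rpredZ //.
exact: span_trans_mul.
Qed.

(** By associativity modulo I, x_(f)((Ty)_(f)z) is reduced to (x_(f)Ty)_(f)z. There x_(f)Ty =
    T(x_(f)y) - (Tx)_(f)y, and each part times z lies in I. *)
Lemma span_mull x u : u \in I -> f_product f x u \in I.
Proof.
move: u; apply: f_product_span_ind => [|k u v uI vI|y z].
- by rewrite -(scale0r 0) f_productZr scale0r rpred0.
- by rewrite f_product_lin_r // rpredD ?rpredZ.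
rewrite -[f_product _ y z]opprK -f_product_transl -scaleN1r f_productZr rpredZ //.
have E : f_product f (f_product f x (T y)) z \in I.
  have -> : f_product f x (T y) = - 1 *: f_product f (T x) y + T (f_product f x y).
    by rewrite trans_f_product scaleN1r addKr.
  rewrite f_product_lin_l // rpredD ?rpredZ //; first exact: span_trans_mul.
  by rewrite f_product_transl rpredN f_product_in_span.
have := f_product_assoc_mod x (T y) z.
by rewrite rpredBl.
Qed.

Lemma f_product_vacl x : f_product f (vac VA) x = x.
Proof.
case: Rf => _ f1 _; rewrite f_productE (zsum_only (i0 := - 1)) => [|i i1].
  by rewrite f1 scale1r /nprod vac_left.
rewrite /nprod vac_left (_ : (- 1 - i == 0) = false) ?scaler0 //.
by apply/negbTE; apply: contraNneq i1; lia.
Qed.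

(** The vacuum kills the modes m >= 0 and the simple pole of f excludes m < -1, leaving x(-1)1 = x
    with residue 1. *)
Lemma f_product_vacr x : f_product f x (vac VA) = x.
Proof.
case: Rf => f0 f1 _; rewrite f_productE (zsum_only (i0 := - 1)) => [|i i1].
  by rewrite f1 scale1r /nprod vac_right.
have [i0|i0] := ltP i 0; last by rewrite nprod_vac_ge0 ?scaler0.
by rewrite f0 ?scale0r //; lia.
Qed.

Lemma riccati_quotient_algebra :
  exists mul : quot_space VA (lderiv f) -> quot_space VA (lderiv f) ->
               quot_space VA (lderiv f),
    (forall a b : V, mul (qclass VA _ a) (qclass VA _ b)
                     = qclass VA _ (f_product f a b)) /\
    is_unital_assoc_algebra mul (qclass VA _ (vac VA)).
Proof.
pose q := qclass VA (lderiv f).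
pose rep u := projT1 (cid (@qclass_surj _ _ VA (lderiv f) u)).
have repK u : u = q (rep u) by rewrite /rep; case: cid.
pose mul u v := q (f_product f (rep u) (rep v)).
have mulE a b : mul (q a) (q b) = q (f_product f a b).
  have sub a0 : rep (q a0) - a0 \in I by apply/qclass_eq; rewrite -/q -repK.
  apply/qclass_eq.
  (* Changing one factor at a time leaves two differences, one for each side of the ideal. *)
  have -> : f_product f (rep (q a)) (rep (q b)) - f_product f a b =
      f_product f (rep (q a) - a) (rep (q b)) + f_product f a (rep (q b) - b).
    rewrite f_productDl // f_productDr // -(scaleN1r a) -(scaleN1r b).
    by rewrite f_productZl f_productZr !scaleN1r addrA subrK.
  by rewrite rpredD //; [apply: span_mulr | apply: span_mull]; exact: sub.
exists mul; split=> //; split.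
- move=> y k u v; rewrite (repK y) (repK u) (repK v).
  by rewrite -linearP !mulE -linearP f_product_lin_l.
- move=> y k u v; rewrite (repK y) (repK u) (repK v).
  by rewrite -linearP !mulE -linearP f_product_lin_r.
- move=> u v w; rewrite (repK u) (repK v) (repK w) !mulE.
  apply/esym/qclass_eq; exact: f_product_assoc_mod.
- by move=> u; rewrite (repK u) mulE f_product_vacl.
- by move=> u; rewrite (repK u) mulE f_product_vacr.
Qed.

End QuotientAlgebra.

Theorem proposition3p12 (R : realType) (V : lmodType R[i])
    (VA : vertex_algebra V) (f g : int -> R[i])
    (hf : f = monomial R[i] (- 1) \/
          exists c : R[i], c != 0 /\ is_exp_kernel c f)
    (hg : g = laurent_deriv (f : int -> R[i]^o)) :
  exists mul : quot_space VA g -> quot_space VA g -> quot_space VA g,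
    (forall a b : V,
       mul (qclass VA g a) (qclass VA g b)
       = qclass VA g (f_product VA f a b)) /\
    is_unital_assoc_algebra mul (qclass VA g (vac VA)).
Proof.
have [c Rf] : exists c : R[i], riccati c f.
  case: hf => [->|[c [c0 fK]]]; first by exists 0; exact: riccati_monomial.
  by exists c; exact: riccati_exp.
by rewrite hg; exact: riccati_quotient_algebra Rf.
Qed.
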